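(* Let $b,m,s$ be positive integers with $b\ge2$ and let $0\le x\le1$. Then $Q_s(b,m,x)\le0$, where $$Q_s(b,m,x):=1-b^mI_x(m,s+1)-\left(\frac{1-x}{1-bx}\right)^sI_{1-bx}(s+1,m).$$
   Context: For positive integers $p,q$ and real $y$, $B_y(p,q)=\int_0^yt^{p-1}(1-t)^{q-1}\,dt$ (also for negative $y$), $B(p,q)=B_1(p,q)=\frac{\Gamma(p)\Gamma(q)}{\Gamma(p+q)}$, and $I_y(p,q)=B_y(p,q)/B(p,q)$ is the normalized (regularized incomplete) beta function. At $x=1/b$ the expression $Q_s(b,m,x)$ is understood by continuity: since $I_{1-bx}(s+1,m)$ is a polynomial divisible by $(1-bx)^{s+1}$, the last term has value $0$ there. *)

(* Defs.v *)
From Stdlib Require Import Reals Lra Lia.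
From Coquelicot Require Import Coquelicot.

Open Scope R_scope.

(* Meant for p, q >= 1. RInt is oriented, so this also covers y < 0. *)
Definition inc_beta (y : R) (p q : nat) : R :=
  RInt (fun t => t ^ (p - 1) * (1 - t) ^ (q - 1)) 0 y.

Definition beta (p q : nat) : R := inc_beta 1 p q.

Definition reg_inc_beta (y : R) (p q : nat) : R := inc_beta y p q / beta p q.

(* At x = 1/b the quotient divides by zero, but its factor reg_inc_beta 0 is 0,
   so the last term is 0 (see Q_last_term_at_inv). This is the value given by
   continuity: reg_inc_beta (1 - b x) (s + 1) m is a polynomial in x divisible
   by (1 - b x)^(s + 1). *)
Definition Q (s b m : nat) (x : R) : R :=
  1 - INR b ^ m * reg_inc_beta x m (s + 1)
    - ((1 - x) / (1 - INR b * x)) ^ s * reg_inc_beta (1 - INR b * x) (s + 1) m.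

Lemma Q_last_term_at_inv (s b m : nat) (x : R) : INR b * x = 1 ->
  ((1 - x) / (1 - INR b * x)) ^ s * reg_inc_beta (1 - INR b * x) (s + 1) m = 0.
Proof.
intros Hx; rewrite Hx, Rminus_diag; unfold reg_inc_beta, inc_beta.
rewrite RInt_point; unfold zero; simpl; unfold Rdiv; ring.
Qed.

(* Main.v *)
Require Import Defs.
From Stdlib Require Import Reals Lra Lia.
From Coquelicot Require Import Coquelicot.

Open Scope R_scope.

(** Let [S_s(z)] be the sum of [C(s+k,k) z^k] over [k < m], a truncation of
    [(1-z)^-(s+1)]. Then [I_z(m,s+1) = 1 - (1-z)^(s+1) S_s(z)] and, by symmetry,
    [I_{1-z}(s+1,m) = (1-z)^(s+1) S_s(z)], so
    [Q_s = 1 - b^m + (1-x)^s (b^m (1-x) S_s(x) - (1-bx) S_s(bx))].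
    Pascal's rule gives [(1-z) S_s(z) = S_{s-1}(z) - C(s+m-1,m-1) z^m]; the terms
    in [z^m] cancel, and [S_{s-1}(bx) >= S_{s-1}(x)], hence
    [Q_s <= (b^m - 1) ((1-x)^s S_{s-1}(x) - 1)], where
    [(1-x)^s S_{s-1}(x) = 1 - I_x(m,s) <= 1]. *)

(* Coquelicot's complex numbers shadow the name [C]. *)
Local Notation binom := Binomial.C.

(* [n] is the top index, so the [S_s] attached to [m] is [negbin_sum s (m - 1)]. *)
Definition negbin_sum (s n : nat) (z : R) : R :=
  sum_f_R0 (fun k => binom (s + k) k * z ^ k) n.

Lemma binom_n_0 (n : nat) : binom n 0 = 1.
Proof.
unfold Binomial.C; rewrite Nat.sub_0_r; simpl Factorial.fact; simpl INR.
field; apply INR_fact_neq_0.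
Qed.

Lemma binom_pos (n k : nat) : 0 < binom n k.
Proof.
apply Rdiv_lt_0_compat; [|apply Rmult_lt_0_compat]; apply INR_fact_lt_0.
Qed.

(** Absorption: both sides equal [(s+k+1)! / (s! k!)]. This is what makes the sum in
    [is_derive_negbin] telescope. *)
Lemma binom_SS (s k : nat) :
  INR (S k) * binom (s + S k) (S k) = INR (s + S k) * binom (s + k) k.
Proof.
unfold Binomial.C; replace (s + S k - S k)%nat with s by lia.
replace (s + k - k)%nat with s by lia.
replace (s + S k)%nat with (S (s + k)) by lia.
rewrite !fact_simpl, !mult_INR.
field; repeat split; try apply INR_fact_neq_0; apply not_0_INR; lia.
Qed.

Lemma negbin_sum_S (s n : nat) (z : R) :
  negbin_sum s (S n) z = negbin_sum s n z + binom (s + S n) (S n) * z ^ S n.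
Proof. reflexivity. Qed.

Lemma negbin_sum_0 (s n : nat) : negbin_sum s n 0 = 1.
Proof.
induction n as [|n IH].
- unfold negbin_sum; simpl sum_f_R0; rewrite binom_n_0; ring.
- rewrite negbin_sum_S, IH; simpl pow; ring.
Qed.

Lemma negbin_sum_pascal (s n : nat) (z : R) :
  (1 - z) * negbin_sum (S s) n z =
  negbin_sum s n z - binom (S s + n) n * z ^ S n.
Proof.
induction n as [|n IH].
- unfold negbin_sum; simpl sum_f_R0; rewrite !binom_n_0; simpl; ring.
- rewrite !negbin_sum_S, Rmult_plus_distr_l, IH.
  replace (S s + S n)%nat with (S (s + S n)) by lia.
  rewrite <- (pascal (s + S n) n) by lia.
  replace (S s + n)%nat with (s + S n)%nat by lia.
  simpl pow; ring.
Qed.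

(** Base case of the induction on [s] in [negbin_sum_le_1]: all coefficients [C(k,k)] are 1. *)
Lemma negbin_sum_geometric (n : nat) (z : R) :
  (1 - z) * negbin_sum 0 n z = 1 - z ^ S n.
Proof.
assert (HC : forall k, binom (0 + k) k = 1).
{ intros k; rewrite <- (binom_n_0 k), pascal_step1, Nat.add_0_l, Nat.sub_diag by lia.
  reflexivity. }
induction n as [|n IH].
- unfold negbin_sum; simpl sum_f_R0; rewrite binom_n_0; simpl; ring.
- rewrite negbin_sum_S, Rmult_plus_distr_l, IH, HC; simpl pow; ring.
Qed.

Lemma negbin_sum_le_1 (s n : nat) (z : R) :
  0 <= z <= 1 -> (1 - z) ^ S s * negbin_sum s n z <= 1.
Proof.
intros Hz; induction s as [|s IH].
- rewrite pow_1, negbin_sum_geometric.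
  assert (0 <= z ^ S n) by (apply pow_le; lra); lra.
- apply Rle_trans with (2 := IH).
  change ((1 - z) ^ S (S s)) with ((1 - z) * (1 - z) ^ S s).
  rewrite (Rmult_comm (1 - z)), Rmult_assoc.
  apply Rmult_le_compat_l; [apply pow_le; lra|].
  rewrite negbin_sum_pascal.
  assert (0 <= binom (S s + n) n * z ^ S n); [|lra].
  apply Rmult_le_pos; [apply Rlt_le, binom_pos|apply pow_le; lra].
Qed.

Lemma negbin_sum_incr (s n : nat) (y z : R) :
  0 <= y <= z -> negbin_sum s n y <= negbin_sum s n z.
Proof.
intros Hyz; apply sum_Rle; intros k _.
apply Rmult_le_compat_l; [apply Rlt_le, binom_pos|apply pow_incr; lra].
Qed.

(** Differentiating term by term telescopes: only the top index contributes, and it gives a multiple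
    of the beta integrand. *)
Lemma is_derive_negbin (s n : nat) (z : R) :
  is_derive (fun t => (1 - t) ^ S s * negbin_sum s n t) z
    (- (INR (s + S n) * binom (s + n) n) * (z ^ n * (1 - z) ^ s)).
Proof.
induction n as [|n IH].
- apply is_derive_ext with (fun t => (1 - t) ^ S s).
  { intros t; unfold negbin_sum; simpl sum_f_R0; rewrite binom_n_0; simpl; ring. }
  rewrite binom_n_0, Nat.add_1_r.
  auto_derive; [easy|].
  change (match s with 0%nat => 1 | S _ => INR s + 1 end) with (INR (S s)).
  fold (1 - z); simpl pow; ring.
- apply is_derive_ext with (fun t => (1 - t) ^ S s * negbin_sum s n t
    + binom (s + S n) (S n) * ((1 - t) ^ S s * t ^ S n)).
  { intros t; rewrite negbin_sum_S; simpl; ring. }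
  assert (H : is_derive
    (fun t => binom (s + S n) (S n) * ((1 - t) ^ S s * t ^ S n)) z
    (binom (s + S n) (S n) * (INR (S n) * z ^ n * (1 - z) ^ S s
      - INR (S s) * (1 - z) ^ s * z ^ S n))).
  { auto_derive; [easy|].
    change (match s with 0%nat => 1 | S _ => INR s + 1 end) with (INR (S s)).
    change (match n with 0%nat => 1 | S _ => INR n + 1 end) with (INR (S n)).
    fold (1 - z); simpl pow; ring. }
  replace (- _ * _) with
    (- (INR (s + S n) * binom (s + n) n) * (z ^ n * (1 - z) ^ s)
     + binom (s + S n) (S n) * (INR (S n) * z ^ n * (1 - z) ^ S s
      - INR (S s) * (1 - z) ^ s * z ^ S n)).
  + exact (is_derive_plus _ _ z _ _ IH H).
  (* With [C(s+n+1,n+1)] and [z^n (1-z)^s] factored out, what remains is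
     [-(n+1) + (n+1)(1-z) - (s+1)z = -(s+n+2)z]. *)
  + rewrite <- binom_SS.
    rewrite !plus_INR, !S_INR; simpl pow; ring.
Qed.

(** The constant is [1/B(n+1,s+1)]; positivity justifies dividing by it. *)
Lemma beta_constant_pos (s n : nat) : 0 < INR (s + S n) * binom (s + n) n.
Proof.
apply Rmult_lt_0_compat; [apply lt_0_INR; lia|apply binom_pos].
Qed.

Lemma continuous_beta_integrand (p q : nat) (t : R) :
  continuous (fun t => t ^ p * (1 - t) ^ q) t.
Proof.
apply (ex_derive_continuous (fun t => t ^ p * (1 - t) ^ q)); auto_derive; easy.
Qed.

Lemma inc_beta_negbin (s n : nat) (y : R) :
  inc_beta y (S n) (s + 1) =
  (1 - (1 - y) ^ S s * negbin_sum s n y) / (INR (s + S n) * binom (s + n) n).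
Proof.
assert (Hc := beta_constant_pos s n); set (c := _ * binom _ _) in *.
unfold inc_beta; replace (S n - 1)%nat with n by lia.
replace (s + 1 - 1)%nat with s by lia.
apply is_RInt_unique.
set (F t := - / c * ((1 - t) ^ S s * negbin_sum s n t)).
replace (_ / c) with (minus (F y) (F 0)).
- apply (is_RInt_derive F).
  + intros t _; unfold F.
    replace (_ * _) with (- / c * (- c * (t ^ n * (1 - t) ^ s)))
      by (field; lra).
    apply (is_derive_scal (fun t => _) t), is_derive_negbin.
  + intros t _; apply continuous_beta_integrand.
- unfold minus, plus, opp, F; simpl; rewrite negbin_sum_0, Rminus_0_r, pow1.
  field; lra.
Qed.

(** The substitution [t -> 1-t] turns the previous antiderivative into one that vanishes at 0. *)
Lemma inc_beta_negbin_sym (s n : nat) (y : R) :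
  inc_beta y (s + 1) (S n) =
  y ^ S s * negbin_sum s n (1 - y) / (INR (s + S n) * binom (s + n) n).
Proof.
assert (Hc := beta_constant_pos s n); set (c := _ * binom _ _) in *.
unfold inc_beta; replace (S n - 1)%nat with n by lia.
replace (s + 1 - 1)%nat with s by lia.
apply is_RInt_unique.
set (F t := / c * ((1 - (1 - t)) ^ S s * negbin_sum s n (1 - t))).
replace (_ / c) with (minus (F y) (F 0)).
- apply (is_RInt_derive F).
  + intros t _; unfold F.
    replace (t ^ s * _) with
      (* The factor [-1] is the derivative of [1 - t], as the chain rule produces it. *)
      (/ c * (-1 * (- c * ((1 - t) ^ n * (1 - (1 - t)) ^ s)))).
    2: { replace (1 - (1 - t)) with t by ring; field; lra. }
    apply (is_derive_scal (fun t => _) t).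
    apply (is_derive_comp
      (fun u => (1 - u) ^ S s * negbin_sum s n u) (fun t => 1 - t)).
    * apply is_derive_negbin.
    * auto_derive; [easy|ring].
  + intros t _; apply continuous_beta_integrand.
- unfold minus, plus, opp, F; simpl.
  replace (1 - (1 - y)) with y by ring; replace (1 - (1 - 0)) with 0 by ring.
  field; lra.
Qed.

Lemma reg_inc_beta_negbin (s n : nat) (y : R) :
  reg_inc_beta y (S n) (s + 1) = 1 - (1 - y) ^ S s * negbin_sum s n y.
Proof.
assert (Hc := beta_constant_pos s n).
unfold reg_inc_beta, beta; rewrite !inc_beta_negbin, Rminus_diag.
set (c := _ * binom _ _) in *; rewrite (pow_i (S s)) by lia.
field; lra.
Qed.

Lemma reg_inc_beta_negbin_sym (s n : nat) (y : R) :
  reg_inc_beta y (s + 1) (S n) = y ^ S s * negbin_sum s n (1 - y).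
Proof.
assert (Hc := beta_constant_pos s n).
unfold reg_inc_beta, beta; rewrite !inc_beta_negbin_sym.
rewrite Rminus_diag, negbin_sum_0, pow1.
set (c := _ * binom _ _) in *.
field; lra.
Qed.

(** The quotient cancels [s] of the [s+1] factors [1-bx] in [reg_inc_beta]; at [bx = 1] both sides
    are 0. *)
Lemma Q_last_term (s n b : nat) (x : R) :
  ((1 - x) / (1 - INR b * x)) ^ s
    * reg_inc_beta (1 - INR b * x) (s + 1) (S n) =
  (1 - x) ^ s * ((1 - INR b * x) * negbin_sum s n (INR b * x)).
Proof.
destruct (Req_dec (INR b * x) 1) as [H|H].
- rewrite Q_last_term_at_inv by exact H; rewrite H; ring.
- rewrite reg_inc_beta_negbin_sym; unfold Rdiv; rewrite Rpow_mult_distr, pow_inv.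
  replace (1 - (1 - INR b * x)) with (INR b * x) by ring.
  simpl pow; field; apply pow_nonzero; lra.
Qed.

Theorem theorem17 (b m s : nat) (x : R)
  (hb : (2 <= b)%nat) (hm : (1 <= m)%nat) (hs : (1 <= s)%nat)
  (hx : 0 <= x <= 1) : Q s b m x <= 0.
Proof.
destruct m as [|n]; [lia|]; destruct s as [|r]; [lia|].
unfold Q; rewrite Q_last_term, reg_inc_beta_negbin.
assert (Hb : 1 <= INR b) by (apply (le_INR 1); lia).
assert (Hbm : 1 <= INR b ^ S n) by (apply pow_R1_Rle; lra).
assert (Hp : 0 <= (1 - x) ^ S r) by (apply pow_le; lra).
(* One factor [1-x] moves next to the sum, so that Pascal's rule applies at [x] as it does at
   [bx]. *)
replace ((1 - x) ^ S (S r) * negbin_sum (S r) n x) with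
  ((1 - x) ^ S r * ((1 - x) * negbin_sum (S r) n x)) by (simpl pow; ring).
rewrite !negbin_sum_pascal, Rpow_mult_distr.
(* Here [bx] may exceed 1; monotonicity holds on all nonnegative reals. *)
assert (Hmono : negbin_sum r n x <= negbin_sum r n (INR b * x))
  by (apply negbin_sum_incr; nra).
assert (Hle := negbin_sum_le_1 r n x hx).
(* With these weights, adding the two inequalities bounds [Q] by 0, the [x^m] terms cancelling. *)
apply Rmult_le_compat_l with (r := (1 - x) ^ S r) in Hmono; [|exact Hp].
apply Rmult_le_compat_l with (r := INR b ^ S n - 1) in Hle; [|lra].
lra.
Qed.
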